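(* Let $\alpha=\frac{1+\sqrt5}{2}$ and $\beta=\frac{1-\sqrt5}{2}$. For every integer $n\ge 3$, $$\sigma_1(C_n)=\frac{n}{\sqrt5}\left(\alpha^{n-2}-\beta^{n-2}\right).$$
   Context: $C_n$ is the cycle graph on $n\ge 3$ vertices. For a finite simple undirected graph $G$, $\sigma_1(G)$ denotes the number of $1$-nearly independent vertex subsets of $G$, i.e. the number of subsets $I$ of the vertex set $V(G)$ such that the subgraph of $G$ induced by $I$ has exactly one edge. *)

(* Defs.v *)
From mathcomp Require Import all_boot all_order all_algebra.
Set Implicit Arguments.
Unset Strict Implicit.
Unset Printing Implicit Defensive.

(* Finite simple undirected graphs. *)
Record sgraph := SGraph {
  svertex :> finType;
  sedge : rel svertex;
  sedge_sym : symmetric sedge;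
  sedge_irrefl : irreflexive sedge
}.

(* An edge is an unordered pair, so each edge is counted once. *)
Definition edges (G : sgraph) : {set {set G}} :=
  [set e : {set G} | [exists x : G, exists y : G,
                        sedge x y && (e == [set x; y])]].

Section Induced.
Variables (G : sgraph) (I : {set G}).

Definition induced_rel : rel {x : G | x \in I} :=
  fun x y => sedge (val x) (val y).

Lemma induced_sym : symmetric induced_rel.
Proof. by move=> x y; apply: sedge_sym. Qed.

Lemma induced_irrefl : irreflexive induced_rel.
Proof. by move=> x; apply: sedge_irrefl. Qed.

Definition induced : sgraph := SGraph induced_sym induced_irrefl.

End Induced.

Definition nearly_independent (k : nat) (G : sgraph) (I : {set G}) : bool :=
  #|edges (induced I)| == k.

Definition sigma (k : nat) (G : sgraph) : nat :=
  #|[set I : {set G} | nearly_independent k I]|.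

(* [ordS i] is i + 1 modulo n. The conjunct [i != j] only matters for n = 1,
   where it removes the loop; this makes the graph simple for every n. *)
Definition cycle_rel (n : nat) : rel 'I_n :=
  fun i j => (i != j) && ((j == ordS i) || (i == ordS j)).

Lemma cycle_rel_sym (n : nat) : symmetric (@cycle_rel n).
Proof. by move=> i j; rewrite /cycle_rel eq_sym orbC. Qed.

Lemma cycle_rel_irrefl (n : nat) : irreflexive (@cycle_rel n).
Proof. by move=> i; rewrite /cycle_rel eqxx. Qed.

Definition cycle_graph (n : nat) : sgraph :=
  SGraph (@cycle_rel_sym n) (@cycle_rel_irrefl n).

(* Main.v *)
(** Rotating the cycle C_n (n >= 3) reduces the count to n times the number of
    subsets whose only pair of consecutive vertices is {n - 1, 0}. Read as
    0-1 words, these are the words of length n that begin and end with 1 and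
    have no two consecutive 1s; deleting the forced letters shows that there
    are F_(n-2) of them, where F is the Fibonacci sequence. *)
Require Import Defs.
From mathcomp Require Import all_boot all_order all_algebra.
From mathcomp Require Import ring.
Import Order.TTheory GRing.Theory Num.Theory.
Local Open Scope ring_scope.

Lemma card_tuple_cons (T : finType) (m : nat) (P : pred (m.+1.-tuple T)) :
  #|[set t | P t]| = (\sum_x #|[set t : m.-tuple T | P [tuple of x :: t]]|)%N.
Proof.
rewrite -sum1dep_card.
rewrite [RHS](eq_bigr (fun x => \sum_(t : m.-tuple T | P [tuple of x :: t]) 1)%N); last first.
  by move=> x _; rewrite sum1dep_card.
rewrite pair_big_dep /=.
apply: (reindex (fun p : T * m.-tuple T => [tuple of p.1 :: p.2])).
exists (fun t => (thead t, [tuple of behead t])) => /= [[x t] _ | t _].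
  by congr pair; apply: val_inj.
by rewrite [RHS]tuple_eta.
Qed.

Definition nandb (a b : bool) := ~~ (a && b).

(* Words are counted by their extensions of a letter [a], so that the recursion
   on the length closes up; [nand_words false] is the Fibonacci sequence. *)
Definition nand_words (a : bool) (m : nat) : nat :=
  #|[set t : m.-tuple bool | path nandb a t && last a t]|.

Lemma nand_words0 (a : bool) : nand_words a 0 = a.
Proof.
rewrite /nand_words; case: a.
  rewrite (_ : [set _ | _] = setT) ?cardsT ?card_tuple //.
  by apply/setP=> t; rewrite !inE tuple0.
by apply/eqP; rewrite cards_eq0; apply/eqP/setP=> t; rewrite !inE tuple0.
Qed.

(** After a 1 the next letter is forced to be 0. *)
Lemma nand_words_trueS (m : nat) : nand_words true m.+1 = nand_words false m.
Proof.
rewrite /nand_words card_tuple_cons big_bool /=.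
by rewrite (_ : [set _ | false] = set0) ?cards0 //; apply/setP=> t; rewrite !inE.
Qed.

Lemma nand_words_falseS (m : nat) :
  nand_words false m.+1 = (nand_words true m + nand_words false m)%N.
Proof. by rewrite /nand_words card_tuple_cons big_bool. Qed.

Lemma nand_words_false_rec (m : nat) :
  nand_words false m.+2 = (nand_words false m + nand_words false m.+1)%N.
Proof. by rewrite nand_words_falseS nand_words_trueS. Qed.

Lemma nand_words_binet (R : rcfType) (m : nat) :
  let alpha : R := (1 + Num.sqrt 5) / 2 in
  let beta : R := (1 - Num.sqrt 5) / 2 in
  (nand_words false m)%:R = (alpha ^+ m - beta ^+ m) / Num.sqrt 5.
Proof.
move=> alpha beta.
have s5 : Num.sqrt 5 ^+ 2 = 5 :> R by rewrite sqr_sqrtr ?ler0n.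
have s0 : Num.sqrt 5 != 0 :> R by rewrite sqrtr_eq0 -ltNge ltr0n.
(* Stated for any square root e of 5: the two signs give x^2 = 1 + x for both [alpha] and [beta]. *)
have golden (e : R) : e ^+ 2 = 5 -> ((1 + e) / 2) ^+ 2 = 1 + (1 + e) / 2.
  move=> e5; apply/eqP; rewrite -subr_eq0.
  rewrite (_ : _ - _ = (e ^+ 2 - 5) / 4); last by field.
  by rewrite e5 subrr mul0r.
have ha : alpha ^+ 2 = 1 + alpha by exact: golden.
have hb : beta ^+ 2 = 1 + beta by apply: golden; rewrite sqrrN.
(* The recurrence has order two, so the induction carries two consecutive values. *)
suff : (nand_words false m)%:R = (alpha ^+ m - beta ^+ m) / Num.sqrt 5 /\
  (nand_words false m.+1)%:R = (alpha ^+ m.+1 - beta ^+ m.+1) / Num.sqrt 5 by case.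
elim: m => [|m [IH1 IH2]].
  rewrite nand_words_falseS !nand_words0 !expr0 subrr mul0r !expr1; split=> //.
  by rewrite /alpha /beta /=; field.
split=> //; rewrite nand_words_false_rec natrD IH1 IH2.
rewrite -(addn2 m) -(addn1 m) !exprD ha hb !expr1; ring.
Qed.

Lemma addr_neq (V : zmodType) (x y : V) : y != 0 -> x + y != x.
Proof. by rewrite -[X in _ -> _ != X]addr0 (inj_eq (addrI x)). Qed.

Section CycleCount.
Variable m : nat.
Local Notation n := m.+3.
Implicit Types (I : {set 'I_n}) (i j : 'I_n).

(** Each edge {i, i + 1} inside [I] is recorded by its start i. Addition in ['I_n] is modulo n, so
    -1 is the vertex n - 1 and the wrap-around edge is recorded as well. *)
Definition consecutive I : {set 'I_n} := [set i in I | i + 1 \in I].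

Lemma ordS_add1 i : ordS i = i + 1.
Proof. by apply: val_inj; rewrite /= (modn_small (isT : 1 < n)%N) addn1. Qed.

Lemma add1_neq i : i + 1 != i.
Proof. exact: addr_neq. Qed.

(* This is where n >= 3 matters: in C_2 the arcs at 0 and at 1 coincide. *)
Lemma add2_neq i : i + 1 + 1 != i.
Proof. by rewrite -addrA; exact: addr_neq. Qed.

Lemma cycle_relE i j : cycle_rel i j = (j == i + 1) || (i == j + 1).
Proof.
rewrite /cycle_rel !ordS_add1; case: (eqVneq i j) => //= <-.
by rewrite eq_sym (negPf (add1_neq i)).
Qed.

Lemma arc_inj : injective (fun i => [set i; i + 1]).
Proof.
move=> i j /setP e; have := e i; rewrite !inE eqxx /= => /esym/orP[/eqP//|/eqP h].
have := e (i + 1); rewrite !inE eqxx orbT h (negPf (add2_neq j)) /=.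
by rewrite (negPf (add1_neq _)).
Qed.

Lemma card_edges_induced_cycle (I : {set cycle_graph n}) :
  #|edges (induced I)| = #|consecutive I|.
Proof.
(* Edges of [induced I] are sets over a subtype; both counts are moved to families of vertex sets of
   the cycle, along [val] and along the injective map from i to {i, i + 1}. *)
rewrite -(card_imset _ (@imset_inj _ _ _ val_inj)) -(card_imset _ arc_inj).
congr #|pred_of_set _|; apply/setP=> e; apply/imsetP/imsetP.
- case=> d; rewrite inE => /existsP[x /existsP[y /andP[]]].
  rewrite /= /induced_rel /= cycle_relE => xy /eqP-> ->.
  rewrite imsetU1 imset_set1.
  (* The start of the arc is whichever endpoint has the other as its successor. *)
  case/orP: xy => /eqP xy; [exists (val x) | exists (val y)];
    rewrite ?inE -?xy ?(valP x) ?(valP y) //.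
  by rewrite setUC.
- case=> i; rewrite inE => /andP[iI siI] ->.
  exists [set (Sub i iI : induced I); Sub (i + 1) siI]; last first.
    by rewrite imsetU1 imset_set1.
  rewrite inE; apply/existsP; exists (Sub i iI); apply/existsP; exists (Sub (i + 1) siI).
  by rewrite eqxx andbT /= /induced_rel /= cycle_relE eqxx.
Qed.

Definition translate i I : {set 'I_n} := [set j | j + i \in I].

Lemma translate_bij i : bijective (translate i).
Proof.
by exists (translate (- i)) => I; apply/setP=> j; rewrite !inE ?subrK ?addrK.
Qed.

Lemma consecutive_translate i I :
  consecutive (translate i I) = translate i (consecutive I).
Proof. by apply/setP=> j; rewrite !inE addrAC. Qed.

Lemma card_consecutive_set1 i :
  #|[set I | consecutive I == [set i]]| = #|[set I | consecutive I == [set -1]]|.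
Proof.
(* The shift is i + 1 because j + (i + 1) = i exactly when j = -1. *)
rewrite -[RHS](on_card_preimset (f := translate (i + 1))); last first.
  exact/onW_bij/translate_bij.
apply: eq_card => I; rewrite !inE consecutive_translate.
rewrite -(inj_eq (bij_inj (translate_bij (i + 1)))).
congr (_ == _); apply/setP=> j; rewrite !inE.
by rewrite addrCA -subr_eq0 addrAC subrr add0r addr_eq0 -eqr_oppLR eqr_oppLR.
Qed.

Definition word I : n.-tuple bool := [tuple i \in I | i < n].

Lemma word_bij : bijective word.
Proof.
exists (fun t : n.-tuple bool => [set i | tnth t i]) => [I|t].
  by apply/setP=> i; rewrite inE tnth_mktuple.
by apply: eq_from_tnth => i; rewrite tnth_mktuple inE.
Qed.

Lemma nth_word I i : nth false (word I) i = (i \in I).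
Proof. by rewrite -tnth_nth tnth_mktuple. Qed.

Lemma val_N1 : val (-1 : 'I_n) = m.+2.
Proof. by rewrite /= (modn_small (isT : 1 < n)%N) subn1 modn_small. Qed.

Lemma val_add1 i : (i.+1 < n)%N -> val (i + 1) = i.+1.
Proof. by move=> lti; rewrite -ordS_add1 /= modn_small. Qed.

(** Sortedness tests every pair of cyclically adjacent letters except the wrap-around pair; the
    conditions on the first and last letters say that this remaining pair is 1, 1. *)
Lemma consecutive_wordE I :
  (consecutive I == [set -1]) =
  [&& head false (word I), sorted nandb (word I) & last false (word I)].
Proof.
rewrite -nth0 (nth_word I 0).
have -> : last false (word I) = (-1 \in I).
  by rewrite -nth_word val_N1 (last_nth false) size_tuple.
have sortedE : sorted nandb (word I) = [forall i : 'I_n, (i.+1 < n)%N ==> (i \notin consecutive I)].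
  apply/(sortedP false)/forallP => [h i|h i].
    apply/implyP => lti; have := h i; rewrite size_tuple => /(_ lti).
    by rewrite -val_add1 // !nth_word inE.
  rewrite size_tuple => lti; have [j ej] : exists j : 'I_n, i = j.
    by exists (Ordinal (ltnW lti)).
  have := h j; rewrite ej in lti *.
  by rewrite lti -val_add1 // !nth_word inE.
rewrite {}sortedE; apply/eqP/and3P => [eI | [I0 /forallP nI IN1]].
  have : -1 \in consecutive I by rewrite eI set11.
  rewrite inE addNr => /andP[-> ->]; split=> //; apply/forallP => i.
  apply/implyP => lti; rewrite eI inE; apply: contraTneq lti => ->.
  by rewrite val_N1 ltnn.
apply/setP=> i; rewrite in_set1; case: eqVneq => [->|neqi].
  by rewrite inE IN1 addNr I0.
(* Only the last index n - 1, which is -1, has no next letter in the word. *)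
apply/negbTE/(implyP (nI i)); rewrite ltn_neqAle ltn_ord andbT.
by apply: contraNneq neqi => -[eqi]; apply/eqP/val_inj; rewrite val_N1.
Qed.

(** Deleting the initial 1 and the 0 that it forces leaves m + 1 = n - 2 letters; the final 1
    survives as the condition on the last letter. *)
Lemma card_consecutive_setN1 :
  #|[set I | consecutive I == [set -1]]| = nand_words false m.+1.
Proof.
rewrite -nand_words_trueS /nand_words.
transitivity #|[set t : n.-tuple bool |
   [&& head false t, sorted nandb t & last false t]]|.
  rewrite -[RHS](on_card_preimset (f := word)); last exact/onW_bij/word_bij.
  by apply: eq_card => I; rewrite !inE consecutive_wordE.
rewrite card_tuple_cons big_bool /= [X in (_ + X)%N](_ : _ = 0%N) ?addn0 //.
by apply/eqP; rewrite cards_eq0; apply/eqP/setP=> t; rewrite !inE.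
Qed.

(** The sets with exactly one edge are classified by the start of that edge; rotation makes the n
    classes equinumerous. *)
Lemma sigma1_cycle_nat : sigma 1 (cycle_graph n) = (n * nand_words false m.+1)%N.
Proof.
rewrite -card_consecutive_setN1 /sigma -sum1_card.
rewrite (eq_bigl (fun I => #|consecutive I| == 1%N)); last first.
  by move=> I; rewrite inE /nearly_independent card_edges_induced_cycle.
transitivity (\sum_(i : 'I_n) #|[set I | consecutive I == [set i]]|)%N; last first.
  by under eq_bigr do rewrite card_consecutive_set1; rewrite sum_nat_const card_ord.
rewrite [RHS](eq_bigr (fun i => \sum_(I | consecutive I == [set i]) 1)%N); last first.
  by move=> i _; rewrite sum1dep_card.
(* Double counting of pairs (i, I): for fixed I, the number of i with [consecutive I] equal to {i}
   is 1 if that set is a singleton and 0 otherwise. *)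
rewrite (exchange_big_dep xpredT) //= big_mkcond /=; apply: eq_bigr => I _.
rewrite sum1dep_card; case: ifP => [/cards1P[i ->]|/negbT nI].
  by rewrite -(cards1 i); apply: eq_card => j; rewrite !inE (inj_eq set1_inj) eq_sym.
by rewrite eq_card0 // => j; rewrite inE; apply: contraNF nI => /eqP ->; rewrite cards1.
Qed.

End CycleCount.

Theorem mainTheorem9 (R : rcfType) (n : nat) (hn : (3 <= n)%N) :
  let alpha : R := (1 + Num.sqrt 5) / 2 in
  let beta : R := (1 - Num.sqrt 5) / 2 in
  (sigma 1 (cycle_graph n))%:R =
    n%:R / Num.sqrt 5 * (alpha ^+ (n - 2) - beta ^+ (n - 2)).
Proof.
case: n hn => [|[|[|m]]] // _ alpha beta.
rewrite sigma1_cycle_nat natrM nand_words_binet -/alpha -/beta !subSS subn0.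
by rewrite mulrAC mulrA.
Qed.
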